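(* Let $N>2$, let $\Omega\subset\mathbb{R}^N$ be open and bounded, let $1<p<N$, $r>1$ and $0<\theta<\min\{p-1,\frac{p^2}{N-p}\}$, and let $g,h:\Omega\times\mathbb{R}\times\mathbb{R}\to\mathbb{R}$ be Carathéodory functions for which there are constants $c_1,c_2,d_1,d_2>0$ such that, for all $s,t\in\mathbb{R}$ and a.e. $x\in\Omega$, $$c_1|s|^r|t|^{\theta+1}\le g(x,s,t)s,\qquad |g(x,s,t)|\le c_2|s|^{r-1}|t|^{\theta+1},$$ $$d_1|s|^r|t|^{\theta+1}\le h(x,s,t)t,\qquad |h(x,s,t)|\le d_2|s|^r|t|^{\theta}.$$ Let $f\in L^m(\Omega)$ with $f\ge 0$ a.e. in $\Omega$, where $\min\{(r+\theta+1)',(p^* )'\}<m<\frac Np$. Let $(u,v)$ be a solution of the system $$\begin{cases}-\mathrm{div}\Big(\big(\|\nabla u\|_{L^p}^p+\|\nabla v\|_{L^p}^p\big)|\nabla u|^{p-2}\nabla u\Big)+g(x,u,v)=f & \text{in }\Omega,\\ -\mathrm{div}\Big(\big(\|\nabla u\|_{L^p}^p+\|\nabla v\|_{L^p}^p\big)|\nabla v|^{p-2}\nabla v\Big)=h(x,u,v) & \text{in }\Omega,\\ u=v=0 & \text{on }\partial\Omega,\end{cases}$$ with $u\in W^{1,p}_0(\Omega)\cap L^{r+\theta+1}(\Omega)$, $v\in W^{1,p}_0(\Omega)$, and $u,v\ge0$ a.e. in $\Omega$. Then: (I) If $r+\theta>p^*-1$ and $(r+\theta+1)'<m<(p^* )'$,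 then $u$ is Sobolev regularized. (II) If $r+\theta>p^*-1$ and $(p^* )'\le m<\frac{N(r+\theta+1)}{N(p-1)+p(r+\theta+1)}$, then $u$ is Lebesgue regularized. (III) If $r+\theta>p^*-1$, then $v$ is Sobolev regularized.
   Context: Notation: for $1<q<\infty$, $q'=\frac{q}{q-1}$; $p^*=\frac{Np}{N-p}$. For $1\le\tau<\frac Np$, $$\tau_p^*=\frac{N\tau(p-1)}{N-\tau},\qquad \tau_p^{**}=\frac{N\tau(p-1)}{N-\tau p}.$$ Definition of solution: $(u,v)\in W^{1,p}_0(\Omega)\times W^{1,p}_0(\Omega)$ is a solution of the system if $g(\cdot,u,v),h(\cdot,u,v)\in L^1_{loc}(\Omega)$ and, with $\mathcal{A}(u,v)=\|\nabla u\|_{L^p}^p+\|\nabla v\|_{L^p}^p$, $$\mathcal{A}(u,v)\int_\Omega|\nabla u|^{p-2}\nabla u\cdot\nabla\varphi+\int_\Omega g(x,u,v)\varphi=\int_\Omega f\varphi\quad\forall\varphi\in C_c^\infty(\Omega),$$ $$\mathcal{A}(u,v)\int_\Omega|\nabla v|^{p-2}\nabla v\cdot\nabla\psi=\int_\Omega h(x,u,v)\psi\quad\forall\psi\in C_c^\infty(\Omega).$$ Definition of regularized: for a distributional solution $w\in W^{1,1}_0(\Omega)$ of a $p$-Laplacian-type equation with datum $F\in L^\tau(\Omega)$, $1\le\tau<\frac Np$: $w$ is Lebesgue regularized if $w\in L^q(\Omega)$ for some $q>\max\{\tau_p^{**},1\}$; $w$ is Sobolev regularized if $w\in W^{1,q}_0(\Omega)$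 for some $q>\max\{\tau_p^*,1\}$. These notions are applied to the two equations as follows. For $u$, the datum is $f\in L^m(\Omega)$, so $\tau=m$. For $v$, the datum is $h(\cdot,u,v)$: ''$v$ is Sobolev regularized'' means that there is $\tau\in[1,\frac Np)$ with $h(\cdot,u,v)\in L^\tau(\Omega)$ and $v\in W^{1,q}_0(\Omega)$ for some $q>\max\{\tau_p^*,1\}$. *)

(* Defs.v *)
From HB Require Import structures.
From mathcomp Require Import all_boot all_order all_algebra.
From mathcomp Require Import all_classical all_reals all_analysis.

Set Implicit Arguments.
Unset Strict Implicit.
Unset Printing Implicit Defensive.

Import Order.TTheory GRing.Theory Num.Theory.
Import numFieldNormedType.Exports.

Local Open Scope classical_set_scope.
Local Open Scope ring_scope.

(* Lebesgue measure on R^N, with R^N := 'rV[R]_N: the outer measure given by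
   countable covers by closed boxes, restricted to its Caratheodory
   sigma-algebra (so that the measure is complete). *)

(* The option makes finite (in particular empty) covers available as sequences:
   for N = 0 every genuine box has volume 1. *)
Definition box (R : realType) (N : nat) (B : option ('rV[R]_N * 'rV[R]_N)) :
    set 'rV[R]_N :=
  if B is Some (a, b) then [set x | forall i, a 0 i <= x 0 i <= b 0 i]
  else set0.

Definition box_volume (R : realType) (N : nat)
    (B : option ('rV[R]_N * 'rV[R]_N)) : R :=
  if B is Some (a, b) then \prod_(i < N) Num.max 0 (b 0 i - a 0 i) else 0.

Definition lebesgue_outer (R : realType) (N : nat) (A : set 'rV[R]_N) :
    \bar R :=
  ereal_inf [set (\sum_(0 <= k <oo) (box_volume (B k))%:E)%E
            | B in [set B : nat -> option ('rV[R]_N * 'rV[R]_N)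
                   | A `<=` \bigcup_k box (B k)]].

Section lebesgue_outer_measure.
Local Open Scope ereal_scope.
Context (R : realType) (N : nat).
Local Notation RN := 'rV[R]_N.
Local Notation Box := (option (RN * RN)).
Implicit Types (A : set RN) (B : nat -> Box).

Lemma box_volume_ge0 (B : Box) : 0 <= (box_volume B)%:E.
Proof.
rewrite lee_fin; case: B => [[a b]|] //=.
by apply: prodr_ge0 => i _; rewrite le_max lexx.
Qed.

Lemma lebesgue_outer_ge0 A : 0 <= lebesgue_outer A.
Proof.
apply: le_ereal_inf_tmp => _ [B _ <-].
by apply: nneseries_ge0 => k _ _; exact: box_volume_ge0.
Qed.

Lemma lebesgue_outer0 : lebesgue_outer (set0 : set RN) = 0.
Proof.
apply/eqP; rewrite eq_le lebesgue_outer_ge0 andbT.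
apply: ereal_inf_lbound; exists (fun=> None) => //=.
by rewrite eseries0.
Qed.

Lemma le_lebesgue_outer :
  {homo (@lebesgue_outer R N) : A1 A2 / A1 `<=` A2 >-> A1 <= A2}.
Proof.
move=> A1 A2 A12; apply/ereal_inf_le_tmp => _ [B A2B <-].
by exists B => //; exact: subset_trans A12 A2B.
Qed.

Lemma lebesgue_outer_sigma_subadditive :
  sigma_subadditive (@lebesgue_outer R N).
Proof.
move=> A; have [[i ioo]|] := pselect (exists i, lebesgue_outer (A i) = +oo).
  rewrite (eseries_pinfty _ _ ioo) ?leey// => n _.
  by rewrite -ltNye (lt_le_trans _ (lebesgue_outer_ge0 _)).
rewrite -forallNE => Aoo.
suff add2e (e : {posnum R}) : lebesgue_outer (\bigcup_n A n) <=
    \sum_(0 <= i <oo) lebesgue_outer (A i) + e%:num%:E.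
  by apply/lee_addgt0Pr => _/posnumP[].
rewrite (le_trans _ (epsilon_trick _ _ _))//; last first.
  by move=> n; exact: lebesgue_outer_ge0.
pose P n B := A n `<=` \bigcup_k box (B k) /\
  \sum_(0 <= k <oo) (box_volume (B k))%:E <=
    lebesgue_outer (A n) + (e%:num / (2 ^ n.+1)%:R)%:E.
have [G PG] : {G : nat -> nat -> Box & forall n, P n (G n)}.
  apply: (@choice _ _ P) => n; rewrite /P.
  have fA : lebesgue_outer (A n) \is a fin_num.
    by rewrite ge0_fin_numE ?lebesgue_outer_ge0// ltey; apply/eqP/Aoo.
  have en1 : (0 < e%:num / (2 ^ n.+1)%:R)%R by [].
  have [_ [B AnB <-] BA] := lb_ereal_inf_adherent en1 fA.
  by exists B; split => //; exact/ltW.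
pose w (ij : nat * nat) := (box_volume (G ij.1 ij.2))%:E : \bar R.
have w_ge0 ij : 0 <= w ij by exact: box_volume_ge0.
apply: (@le_trans _ _ (\esum_(ij in setT) w ij)).
  apply: ereal_inf_lbound => /=.
  have /card_esym/ppcard_eqP[f] := card_nat2.
  exists (fun k => G (f k).1 (f k).2) => /=.
    move=> t [i _ /(PG i).1[j _ Gijt]].
    by exists (f^-1%FUN (i, j)) => //=; rewrite invK ?inE.
  rewrite -(esum_pred_image w f xpredT)//; last first.
    by move=> a b _ _; apply: inj; rewrite inE.
  congr esum; apply/seteqP; split => // ij _.
  by exists (f^-1%FUN ij) => //; rewrite invK ?inE.
have w2_ge0 n : 0 <= \sum_(0 <= j <oo) w (n, j).
  by apply: nneseries_ge0 => j _ _; exact: w_ge0.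
rewrite (_ : esum _ _ = \sum_(0 <= i <oo) \sum_(0 <= j <oo) w (i, j)).
  by apply: lee_nneseries => n _; [move=> _; exact: w2_ge0|exact: (PG n).2].
rewrite nneseries_esumT//.
rewrite (eq_esum (b := fun i => \esum_(j in setT) w (i, j))); last first.
  by move=> n _; rewrite nneseries_esumT.
rewrite esum_esum//=; congr esum.
by apply/seteqP; split => // -[].
Qed.

End lebesgue_outer_measure.

HB.instance Definition _ (R : realType) (N : nat) :=
  isOuterMeasure.Build R 'rV[R]_N (@lebesgue_outer R N)
    (@lebesgue_outer0 R N) (@lebesgue_outer_ge0 R N)
    (@le_lebesgue_outer R N) (@lebesgue_outer_sigma_subadditive R N).

HB.instance Definition _ (R : realType) (N : nat) :=
  Measurable.copy 'rV[R]_N (caratheodory_type (@lebesgue_outer R N)).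

Definition lebesgue (R : realType) (N : nat) : set 'rV[R]_N -> \bar R :=
  @lebesgue_outer R N.

HB.instance Definition _ (R : realType) (N : nat) :=
  isMeasure.Build _ 'rV[R]_N R (@lebesgue R N)
    (@caratheodory_measure0 R _ (@lebesgue_outer R N))
    (@caratheodory_measure_ge0 R _ (@lebesgue_outer R N))
    (@caratheodory_measure_sigma_additive R _ (@lebesgue_outer R N)).

Arguments lebesgue {R N} _.

(* The library norm `|x| on 'rV[R]_N is the sup norm; |x| in the equations is
   the Euclidean one. *)
Definition enorm (R : realType) (N : nat) (x : 'rV[R]_N) : R :=
  Num.sqrt (\sum_(i < N) x 0 i ^+ 2).

Definition dotv (R : realType) (N : nat) (x y : 'rV[R]_N) : R :=
  \sum_(i < N) x 0 i * y 0 i.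

(* |x|^{p-2} x; since 0 `^ a is 0 or 1, the value at x = 0 is 0 for every p. *)
Definition p_flux (R : realType) (N : nat) (p : R) (x : 'rV[R]_N) : 'rV[R]_N :=
  (enorm x `^ (p - 2)) *: x.

Definition partial (R : realType) (N : nat) (i : 'I_N) (phi : 'rV[R]_N -> R) :
    'rV[R]_N -> R :=
  fun x => 'D_(delta_mx 0 i) phi x.

Definition gradient (R : realType) (N : nat) (phi : 'rV[R]_N -> R)
    (x : 'rV[R]_N) : 'rV[R]_N :=
  \row_i partial i phi x.

(* C^oo: all iterated partial derivatives, in every order of differentiation,
   exist and are continuous. *)
Definition smooth (R : realType) (N : nat) (phi : 'rV[R]_N -> R) : Prop :=
  forall s : seq 'I_N,
    continuous (foldr (@partial R N) phi s) /\
    forall (i : 'I_N) (x : 'rV[R]_N),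
      derivable (foldr (@partial R N) phi s) x (delta_mx 0 i).

Definition test_function (R : realType) (N : nat) (Om : set 'rV[R]_N)
    (phi : 'rV[R]_N -> R) : Prop :=
  let supp := closure [set x | phi x != 0] in
  [/\ smooth phi, compact supp & supp `<=` Om].

(* Membership in L^q(Om) of a function defined on all of R^N: only its values
   on Om matter. *)
Definition in_Lp (R : realType) (N : nat) (Om : set 'rV[R]_N) (q : R)
    (w : 'rV[R]_N -> R) : Prop :=
  (w \_ Om) \in Lfun lebesgue q%:E.

Definition Lp_cvg (R : realType) (N : nat) (Om : set 'rV[R]_N) (q : R)
    (wn : nat -> 'rV[R]_N -> R) (w : 'rV[R]_N -> R) : Prop :=
  ('N[lebesgue]_q%:E[EFin \o ((wn n \- w)%R \_ Om)] @[n --> \oo] --> 0)%E.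

Definition in_L1loc (R : realType) (N : nat) (Om : set 'rV[R]_N)
    (w : 'rV[R]_N -> R) : Prop :=
  measurable_fun Om w /\
  forall K : set 'rV[R]_N, compact K -> K `<=` Om ->
    lebesgue.-integrable K (EFin \o w).

Definition weak_gradient (R : realType) (N : nat) (Om : set 'rV[R]_N)
    (w : 'rV[R]_N -> R) (Dw : 'rV[R]_N -> 'rV[R]_N) : Prop :=
  [/\ in_L1loc Om w, forall i, in_L1loc Om (fun x => Dw x 0 i)
    & forall (phi : 'rV[R]_N -> R) (i : 'I_N), test_function Om phi ->
        \int[lebesgue]_(x in Om) (w x * partial i phi x) =
        - \int[lebesgue]_(x in Om) (Dw x 0 i * phi x)].

(* w belongs to W^{1,q}_0(Om), the closure of C_c^oo(Om) in W^{1,q}(Om), and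
   Dw represents its weak gradient. *)
Definition W0_grad (R : realType) (N : nat) (Om : set 'rV[R]_N) (q : R)
    (w : 'rV[R]_N -> R) (Dw : 'rV[R]_N -> 'rV[R]_N) : Prop :=
  [/\ in_Lp Om q w, forall i, in_Lp Om q (fun x => Dw x 0 i),
      weak_gradient Om w Dw
    & exists phi : nat -> 'rV[R]_N -> R,
        [/\ forall n, test_function Om (phi n),
            Lp_cvg Om q phi w
          & forall i, Lp_cvg Om q (fun n => partial i (phi n))
                                  (fun x => Dw x 0 i)]].

Definition in_W0 (R : realType) (N : nat) (Om : set 'rV[R]_N) (q : R)
    (w : 'rV[R]_N -> R) : Prop :=
  exists Dw : 'rV[R]_N -> 'rV[R]_N, W0_grad Om q w Dw.

Definition caratheodory_function (R : realType) (N : nat) (Om : set 'rV[R]_N)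
    (g : 'rV[R]_N -> R -> R -> R) : Prop :=
  (forall s t : R, measurable_fun Om (fun x => g x s t)) /\
  {ae lebesgue, forall x, Om x ->
     continuous (fun st : R * R => g x st.1 st.2)}.

Definition energy (R : realType) (N : nat) (Om : set 'rV[R]_N) (p : R)
    (Du Dv : 'rV[R]_N -> 'rV[R]_N) : R :=
  \int[lebesgue]_(x in Om) (enorm (Du x) `^ p) +
  \int[lebesgue]_(x in Om) (enorm (Dv x) `^ p).

Definition solution (R : realType) (N : nat) (Om : set 'rV[R]_N) (p : R)
    (g h : 'rV[R]_N -> R -> R -> R) (f u v : 'rV[R]_N -> R) : Prop :=
  exists Du Dv : 'rV[R]_N -> 'rV[R]_N,
    [/\ W0_grad Om p u Du /\ W0_grad Om p v Dv,
        in_L1loc Om (fun x => g x (u x) (v x)),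
        in_L1loc Om (fun x => h x (u x) (v x)),
        forall phi : 'rV[R]_N -> R, test_function Om phi ->
          energy Om p Du Dv *
            \int[lebesgue]_(x in Om) dotv (p_flux p (Du x)) (gradient phi x) +
          \int[lebesgue]_(x in Om) (g x (u x) (v x) * phi x) =
          \int[lebesgue]_(x in Om) (f x * phi x)
      & forall psi : 'rV[R]_N -> R, test_function Om psi ->
          energy Om p Du Dv *
            \int[lebesgue]_(x in Om) dotv (p_flux p (Dv x)) (gradient psi x) =
          \int[lebesgue]_(x in Om) (h x (u x) (v x) * psi x)].

Definition conj_exp (R : realType) (q : R) : R := q / (q - 1).

(* p^* *)
Definition sobolev_exp (R : realType) (N : nat) (p : R) : R :=
  N%:R * p / (N%:R - p).

(* tau_p^* *)
Definition tau_star (R : realType) (N : nat) (p tau : R) : R :=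
  N%:R * tau * (p - 1) / (N%:R - tau).

(* tau_p^{**} *)
Definition tau_star2 (R : realType) (N : nat) (p tau : R) : R :=
  N%:R * tau * (p - 1) / (N%:R - tau * p).

(* Regularization of w, seen as a solution of an equation driven by the
   p-Laplacian with datum F in L^tau(Om). *)
Definition lebesgue_regularized (R : realType) (N : nat) (Om : set 'rV[R]_N)
    (p : R) (F : 'rV[R]_N -> R) (tau : R) (w : 'rV[R]_N -> R) : Prop :=
  [/\ 1 <= tau < N%:R / p, in_Lp Om tau F
    & exists2 q : R, Num.max (tau_star2 N p tau) 1 < q & in_Lp Om q w].

Definition sobolev_regularized (R : realType) (N : nat) (Om : set 'rV[R]_N)
    (p : R) (F : 'rV[R]_N -> R) (tau : R) (w : 'rV[R]_N -> R) : Prop :=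
  [/\ 1 <= tau < N%:R / p, in_Lp Om tau F
    & exists2 q : R, Num.max (tau_star N p tau) 1 < q & in_W0 Om q w].

(* Main.v *)
Require Import Defs.
From mathcomp Require Import all_boot all_order all_algebra.
From mathcomp Require Import all_classical all_reals all_analysis.
From mathcomp Require Import ring lra measurable_realfun.

(* For (I) and (II) the regularity already assumed is enough: m < (p^* )' means
   m_p^* < p, and the upper bound on m in (II) means m_p^** < r + theta + 1.
   For (III) take tau = 1: since 1_p^* < p, it suffices that h(., u, v) is
   integrable on Om. Test the second equation with psi_n = phi_n^2 / (1 + phi_n^2)
   where phi_n in C_c^oo tends to v in W^{1,p}: psi_n is a nonnegative test
   function with |grad psi_n| <= |grad phi_n|, so the integrals of h psi_n are
   bounded, and in the limit h v^2 / (1 + v^2) is integrable. This controls h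
   where v > 1, while h <= d2 u^r where v <= 1. *)

Set Implicit Arguments.
Unset Strict Implicit.
Unset Printing Implicit Defensive.

Import Order.TTheory GRing.Theory Num.Theory.
Import numFieldNormedType.Exports.

Local Open Scope classical_set_scope.
Local Open Scope ring_scope.

(** * The bounded truncation t^2 / (1 + t^2) *)

Section bump.
Context (R : realType).

(** This is t^2 / (1 + t^2), see [bumpE], spelled with a constant, a product and a sum so that
    [bump (phi x)] matches the constructors of [cutoff_algebra] literally. *)
Definition bump (t : R) : R := 1 + (-1) * (1 + t ^+ 2)^-1.

Lemma bumpE t : bump t = t ^+ 2 / (1 + t ^+ 2).
Proof.
have : 1 + t ^+ 2 != 0 by rewrite gt_eqF// ltr_wpDr ?sqr_ge0.
by rewrite /bump => ?; field.
Qed.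

Lemma bump_ge0 t : 0 <= bump t.
Proof. by rewrite bumpE divr_ge0 ?addr_ge0 ?sqr_ge0. Qed.

Lemma bump_le1 t : bump t <= 1.
Proof. by rewrite /bump mulN1r gerDl oppr_le0 invr_ge0 addr_ge0 ?sqr_ge0. Qed.

Lemma bump_ge_half t : 1 <= t -> 1 <= 2 * bump t.
Proof.
move=> t1; rewrite bumpE mulrA ler_pdivlMr ?ltr_wpDr ?sqr_ge0//.
by nra.
Qed.

Lemma bump_lipschitz s t : `|bump s - bump t| <= `|s - t|.
Proof.
have s0 : 0 < 1 + s ^+ 2 by rewrite ltr_wpDr ?sqr_ge0.
have t0 : 0 < 1 + t ^+ 2 by rewrite ltr_wpDr ?sqr_ge0.
have -> : bump s - bump t = (s - t) * ((s + t) / ((1 + s ^+ 2) * (1 + t ^+ 2))).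
  by rewrite !bumpE; field; rewrite !gt_eqF.
rewrite normrM ler_piMr// normrM normfV (ger0_norm (ltW (mulr_gt0 s0 t0))).
rewrite ler_pdivrMr ?mulr_gt0// mul1r ler_norml.
(* The squares give |s| <= s^2 + 1/4 and the same for t, whence |s + t| <= (1 + s^2) (1 + t^2). *)
have := (sqr_ge0 (s * t), (sqr_ge0 (s - 2^-1), sqr_ge0 (t - 2^-1)),
  (sqr_ge0 (s + 2^-1), sqr_ge0 (t + 2^-1))).
by move=> [[h0 [h1 h2]] [h3 h4]]; apply/andP; split; lra.
Qed.

(* If [k |s - t| <= 1] this is the Lipschitz bound; otherwise [bump s <= 1] and
   [(k |t - s|)^p > 1]. *)
Lemma bump_dist (k p s t : R) : 0 <= k -> 0 < p ->
  k * bump s <= k * bump t + 1 + k * k `^ p * `|t - s| `^ p.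
Proof.
rewrite le_eqVlt => /predU1P[<- _|k0 p0]; first by rewrite !mul0r add0r addr0.
have K0 : 0 <= k * k `^ p * `|t - s| `^ p by rewrite !mulr_ge0 ?powR_ge0// ltW.
have [small|big] := leP (k * `|s - t|) 1.
  have := bump_lipschitz s t; rewrite -(ler_pM2l k0).
  have : k * (bump s - bump t) <= k * `|bump s - bump t|.
    by rewrite ler_pM2l// ler_norm.
  by lra.
have : 1 <= k `^ p * `|t - s| `^ p.
  rewrite -powRM ?(ltW k0)// distrC.
  have {1}-> : 1 = 1 `^ p :> R by rewrite powR1.
  by rewrite ge0_ler_powR ?nnegrE ?(ltW p0) ?(ltW big)// (mulr_ge0 (ltW k0)).
rewrite -(ler_pM2l k0) mulr1 mulrA => H.
have := bump_le1 s; rewrite -(ler_pM2l k0) mulr1.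
by have := mulr_ge0 (ltW k0) (bump_ge0 t); lra.
Qed.

Lemma continuous_bump : continuous bump.
Proof.
move=> t; have n0 : 1 + t ^+ 2 != 0 by rewrite gt_eqF// ltr_wpDr ?sqr_ge0.
have sq : (fun s : R => 1 + s ^+ 2) s @[s --> t] --> 1 + t ^+ 2.
  have id_t : s @[s --> t] --> t by exact: cvg_id.
  exact: (cvgD (cvg_cst (1 : R)) (cvgM id_t id_t)).
exact: (cvgD (cvg_cst _) (cvgM (cvg_cst _) (cvgV n0 sq))).
Qed.

Lemma powR_le_add1 (r s t : R) : 0 <= r -> r <= s -> 0 <= t -> t `^ r <= 1 + t `^ s.
Proof.
move=> r0 rs t0; have [t1|/ltW t1] := leP t 1.
  rewrite (@le_trans _ _ 1)//; last by rewrite lerDl powR_ge0.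
  have {1}-> : 1 = 1 `^ r :> R by rewrite powR1.
  by rewrite ge0_ler_powR ?nnegrE.
by rewrite (@le_trans _ _ (t `^ s))// ?ler_powR// lerDr.
Qed.

End bump.

(** * Borel sets in R^N are Lebesgue measurable *)

Section lebesgue_borel.
Context (R : realType) (N : nat).
Local Notation RN := 'rV[R]_N.

(** The hyperplane x_i = c cuts each covering box into two boxes whose volumes add up, so a cover of
    [X] splits into covers of its two parts at no cost. This is the Caratheodory inequality. *)
Lemma measurable_halfspace (i : 'I_N) (c : R) :
  measurable ([set x : RN | x 0 i <= c] : set RN).
Proof.
apply: le_caratheodory_measurable => X.
set H := [set x : RN | x 0 i <= c].
(* Only the i-th side is clipped at [c]. If the box lies on one side of the hyperplane, the clipped
   length on the other side is nonpositive and the [max] with 0 in [box_volume] discards it. *)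
pose low (B : option (RN * RN)) := if B is Some (a, b) then
  Some (a, \row_j (if j == i then Num.min (b 0 i) c else b 0 j)) else None.
pose high (B : option (RN * RN)) := if B is Some (a, b) then
  Some (\row_j (if j == i then Num.max (a 0 i) c else a 0 j), b) else None.
have volE B : box_volume B = box_volume (low B) + box_volume (high B).
  case: B => [[a b]|] /=; last by rewrite addr0.
  rewrite (bigD1 i) //= [in X in _ = X + _](bigD1 i) //=.
  rewrite [in X in _ = _ + X](bigD1 i) //= !mxE eqxx.
  under [in X in _ = X + _]eq_bigr => j /negbTE ji do rewrite !mxE ji.
  under [in X in _ = _ + X]eq_bigr => j /negbTE ji do rewrite !mxE ji.
  rewrite -mulrDl; congr (_ * _).
  rewrite /Num.max /Num.min.
  move: (a 0 i) (b 0 i) => y z; clear.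
  repeat case: ifPn; rewrite -?leNgt => *; lra.
have lowP B : box B `&` H `<=` box (low B).
  case: B => [[a b]|] //= x.
  move=> [xab xc] j; rewrite mxE; case: eqP => [->|_]; last exact: xab.
  by have /andP[-> xb] := xab i; rewrite le_min xb.
have highP B : box B `&` ~` H `<=` box (high B).
  case: B => [[a b]|] //= x.
  move=> [xab /negP]; rewrite -ltNge => cx j.
  rewrite mxE; case: eqP => [->|_]; last exact: xab.
  by have /andP[xa ->] := xab i; rewrite ge_max xa (ltW cx).
apply: le_ereal_inf_tmp => _ [B XB <-].
have -> : (\sum_(0 <= k <oo) (box_volume (B k))%:E =
   \sum_(0 <= k <oo) (box_volume (low (B k)))%:E +
   \sum_(0 <= k <oo) (box_volume (high (B k)))%:E)%E.
  rewrite -nneseriesD; last 2 first.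
  - by move=> *; exact: box_volume_ge0.
  - by move=> *; exact: box_volume_ge0.
  by apply: eq_eseriesr => k _; rewrite volE EFinD.
apply: leeD; apply: ereal_inf_lbound.
- exists (low \o B) => //= x [/XB[k _ Bx] Hx].
  by exists k => //; exact: lowP.
- exists (high \o B) => //= x [/XB[k _ Bx] Hx].
  by exists k => //; exact: highP.
Qed.

Lemma measurable_halfspace_ge (i : 'I_N) (c : R) :
  measurable ([set x : RN | c <= x 0 i] : set RN).
Proof.
have -> : [set x : RN | c <= x 0 i] =
    \bigcap_n ~` [set x : RN | x 0 i <= c - n.+1%:R^-1].
  apply/seteqP; split => x /=.
    move=> cx n _ /=; apply/negP; rewrite -ltNge (lt_le_trans _ cx)//.
    by rewrite ltrBlDr ltrDl invr_gt0.
  move=> xn; apply/ler_addgt0Pr => e e0.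
  have [n] := ltr_add_invr e0; rewrite add0r => ne.
  have /negP := xn n I; rewrite -ltNge => /ltW.
  by rewrite lerBlDr => /le_trans; apply; rewrite lerD2l ltW.
apply: bigcapT_measurable => n; apply: measurableC.
exact: measurable_halfspace.
Qed.

Lemma measurable_box B : measurable (@box R N B : set RN).
Proof.
case: B => [[a b]|]; last exact: measurable0.
rewrite (_ : box _ = \bigcap_(i in [set: 'I_N])
  ([set x : RN | a 0 i <= x 0 i] `&` [set x : RN | x 0 i <= b 0 i])).
  apply: fin_bigcap_measurable => [|i _]; first exact: finite_finset.
  apply: measurableI; [exact: measurable_halfspace_ge|exact: measurable_halfspace].
apply/seteqP; split => x /= xab i.
  by move=> _; apply/andP/xab.
by have /andP := xab i I.
Qed.

(** The boxes with rational corners that lie in [U] are countably many and fill it. Those that leave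
    [U] are replaced by [None], the empty box, so that the union runs over a countable type. *)
Lemma open_measurable_rV (U : set RN) : open U -> measurable U.
Proof.
move=> oU.
pose F (ab : 'rV[rat]_N * 'rV[rat]_N) : option (RN * RN) :=
  let B := Some (map_mx ratr ab.1, map_mx ratr ab.2) in
  if `[< box B `<=` U >] then B else None.
rewrite (_ : U = \bigcup_ab box (F ab)).
  apply: countable_bigcupT_measurable; first exact: countableP.
  by move=> ab; exact: measurable_box.
apply/seteqP; split => [x Ux|x [ab _]]; last first.
  by rewrite /F; case: asboolP => // abU; exact: abU.
have /nbhs_ballP[e /= e0 xeU] := open_nbhs_nbhs (conj oU Ux).
have A i : {q : rat | x 0 i - e < ratr q < x 0 i}.
  have /cid[q] := @rat_in_itvoo R (x 0 i - e) (x 0 i) ltac:(by rewrite ltrBlDr ltrDl).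
  by rewrite in_itv; exists q.
have B i : {q : rat | x 0 i < ratr q < x 0 i + e}.
  have /cid[q] := @rat_in_itvoo R (x 0 i) (x 0 i + e) ltac:(by rewrite ltrDl).
  by rewrite in_itv; exists q.
exists (\row_i sval (A i), \row_i sval (B i)) => //.
rewrite /F /=; case: asboolP => /=.
  move=> _ i; rewrite !mxE.
  by case: (A i) (B i) => a /= /andP[_ /ltW ->] [b /= /andP[/ltW -> _]].
case=> y /= yab; apply: xeU; split => // i j; rewrite ord1 /ball /= /ball_.
have := yab j; rewrite !mxE.
case: (A j) (B j) => a /= /andP[xa ax] [b /= /andP[xb bx]] /andP[ay yb].
by rewrite ltr_norml; apply/andP; split; lra.
Qed.

Lemma continuous_measurable_rV (D : set RN) (F : RN -> R) :
  continuous F -> measurable_fun D F.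
Proof.
move=> cF mD; apply: (measurability _ (measurable_realfun.RGenOpens.measurableE R)) => // _ [_ [a [b ->] <-]].
apply: measurableI => //; apply: open_measurable_rV.
apply: open_comp => //; exact: interval_open.
Qed.

Lemma lebesgue_bounded_lty (U : set RN) : bounded_set U -> (lebesgue U < +oo)%E.
Proof.
move=> [M [Mr UM]].
pose b : RN := const_mx (M + 1).
(* A single cube of half-side M + 1 covers [U]; the remaining terms of the cover are empty. *)
apply: (@le_lt_trans _ _ (\sum_(0 <= k <oo) (box_volume (if k is 0 then Some (-b, b) else None))%:E)%E).
  apply: ereal_inf_lbound; eexists; last reflexivity.
  move=> x Ux; exists 0%N => //= i.
  have : `|x| <= M + 1 by apply: UM => //; rewrite ltrDl.
  rewrite !mxE -ler_norml => H.
  apply: le_trans H; rewrite /Num.Def.normr /= mx_normrE.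
  exact: (@le_bigmax _ _ _ 0 (fun ij : 'I_1 * 'I_N => `|x ij.1 ij.2|) (0, i)).
rewrite (nneseries_split 0 1); last by move=> k _; exact: box_volume_ge0.
by rewrite big_nat1 eseries0 ?adde0 ?ltry// => -[].
Qed.

End lebesgue_borel.

(** * Composing a test function with [bump] gives a test function *)

Section cutoff.
Context (R : realType) (N : nat) (phi : 'rV[R]_N -> R).
Local Notation RN := 'rV[R]_N.

Definition cutoff_inv : RN -> R := fun x => (1 + phi x ^+ 2)^-1.

(* Contains the iterated partial derivatives of [1 / (1 + phi^2)], so that
   smoothness reduces to one differentiation step in each direction. *)
Inductive cutoff_algebra : (RN -> R) -> Prop :=
| cutoff_partial s : cutoff_algebra (foldr (@partial R N) phi s)
| cutoff_invE : cutoff_algebra cutoff_inv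
| cutoff_cst c : cutoff_algebra (fun=> c)
| cutoff_add a b : cutoff_algebra a -> cutoff_algebra b ->
    cutoff_algebra (fun x => a x + b x)
| cutoff_mul a b : cutoff_algebra a -> cutoff_algebra b ->
    cutoff_algebra (fun x => a x * b x).

Context (sphi : smooth phi).

Lemma cutoff_den_gt0 x : 0 < 1 + phi x ^+ 2.
Proof. by rewrite ltr_wpDr // sqr_ge0. Qed.

Lemma is_derive_phi i x : is_derive x (delta_mx 0 i) phi (partial i phi x).
Proof. exact/derivableP/(sphi [::]).2. Qed.

Lemma is_derive_cutoff_inv i x : is_derive x (delta_mx 0 i) cutoff_inv
  (- (cutoff_inv x ^+ 2 * (2 * phi x * partial i phi x))).
Proof.
have dphi := is_derive_phi i x.
have d2 : is_derive x (delta_mx 0 i) (fun x => 1 + phi x ^+ 2) (2 * phi x * partial i phi x).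
  rewrite (_ : (fun x => _) = cst 1 + phi * phi); last first.
    by apply/funext => y; rewrite !fctE expr2.
  apply: is_derive_eq.
  by rewrite add0r /GRing.scale /=; ring.
have n0 := lt0r_neq0 (cutoff_den_gt0 x).
split; first by apply: derivableV.
by rewrite deriveV// derive_val /GRing.scale /= /cutoff_inv exprVn mulNr.
Qed.

Lemma cutoff_algebra_continuous a : cutoff_algebra a -> continuous a.
Proof.
elim=> [s|||{}a b _ IHa _ IHb|{}a b _ IHa _ IHb].
- exact: (sphi s).1.
- move=> x.
  suff C : (cst 1 \+ (phi \* phi)) y @[y --> x] --> 1 + phi x ^+ 2.
    exact: (cvgV (lt0r_neq0 (cutoff_den_gt0 x)) C).
  have C0 := (sphi [::]).1 x.
  exact: (cvgD (cvg_cst (1 : R)) (cvgM C0 C0)).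
- by move=> c; exact: cst_continuous.
- by move=> x; exact: (cvgD (IHa x) (IHb x)).
- by move=> x; exact: (cvgM (IHa x) (IHb x)).
Qed.

Lemma cutoff_algebra_derivable a : cutoff_algebra a ->
  forall i x, derivable a x (delta_mx 0 i).
Proof.
elim=> [s|||{}a b _ IHa _ IHb|{}a b _ IHa _ IHb] => [i x|i x|c i x|i x|i x].
- exact: (sphi s).2.
- by case: (is_derive_cutoff_inv i x).
- exact: derivable_cst.
- exact: (derivableD (IHa i x) (IHb i x)).
- exact: (derivableM (IHa i x) (IHb i x)).
Qed.

Lemma cutoff_algebra_deriv a : cutoff_algebra a ->
  forall i, cutoff_algebra (partial i a).
Proof.
elim=> [s|||{}a b Ea IHa Eb IHb|{}a b Ea IHa Eb IHb] => [i|i|c i|i|i].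
- exact: (cutoff_partial (i :: s)).
(* The derivative of 1 / (1 + phi^2) is again a product of generators. *)
- rewrite (_ : partial i _ = fun x =>
      (-2) * ((cutoff_inv x * cutoff_inv x) * (phi x * partial i phi x))).
    do !apply: cutoff_mul; [exact: cutoff_cst|exact: cutoff_invE|exact: cutoff_invE| |].
      exact: (cutoff_partial [::]).
    exact: (cutoff_partial [:: i]).
  apply/funext => x; rewrite /partial.
  by have [_ ->] := is_derive_cutoff_inv i x; rewrite /partial; ring.
- rewrite (_ : partial i _ = fun=> 0); first exact: cutoff_cst.
  by apply/funext => x; rewrite /partial derive_cst.
- rewrite (_ : partial i _ = fun x => partial i a x + partial i b x).
    by apply: cutoff_add.
  apply/funext => x; rewrite /partial deriveD//; exact: cutoff_algebra_derivable.
- rewrite (_ : partial i _ = fun x => a x * partial i b x + b x * partial i a x).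
    by apply: cutoff_add; apply: cutoff_mul.
  apply/funext => x; rewrite /partial deriveM//; exact: cutoff_algebra_derivable.
Qed.

Lemma cutoff_algebra_smooth a : cutoff_algebra a -> smooth a.
Proof.
move=> Ea s; suff H : cutoff_algebra (foldr (@partial R N) a s).
  by split; [exact: cutoff_algebra_continuous|exact: cutoff_algebra_derivable].
by elim: s => //= i s IH; exact: cutoff_algebra_deriv.
Qed.

Definition cutoff : RN -> R := fun x => bump (phi x).

Lemma cutoff_smooth : smooth cutoff.
Proof.
rewrite /cutoff /bump; apply: cutoff_algebra_smooth; apply: cutoff_add; first exact: cutoff_cst.
by apply: cutoff_mul; [exact: cutoff_cst|exact: cutoff_invE].
Qed.

Lemma partial_cutoff i x :
  partial i cutoff x = cutoff_inv x ^+ 2 * (2 * phi x) * partial i phi x.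
Proof.
have H := is_derive_cutoff_inv i x.
rewrite {1}/partial.
rewrite (_ : cutoff = cst 1 - cutoff_inv); last first.
  by apply/funext => y; rewrite !fctE /cutoff /bump mulN1r.
rewrite deriveB//.
by rewrite derive_cst derive_val; ring.
Qed.

(** [bump] vanishes only at 0, so [cutoff] has the same support as [phi]. *)
Lemma cutoff_test_function (Om : set RN) :
  test_function Om phi -> test_function Om cutoff.
Proof.
move=> [_ cs sOm]; rewrite /test_function.
rewrite (_ : [set x | cutoff x != 0] = [set x | phi x != 0]); first by split=> //; exact: cutoff_smooth.
apply/seteqP; split => x /=; apply: contra => /eqP.
  by move=> p0; rewrite /cutoff /bump p0 expr0n addr0 invr1 mulr1 subrr.
rewrite /cutoff /bump mulN1r => /subr0_eq/esym/(canRL invrK).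
rewrite invr1 => /(canRL (addKr _)); rewrite addNr => /eqP.
by rewrite sqrf_eq0.
Qed.

End cutoff.

(** * Pointwise bounds on the source term *)

Section growth.
Context (R : realType) (N : nat).
Local Notation RN := 'rV[R]_N.

Lemma rat_approx_below (s e : R) : 0 <= s -> 0 < e ->
  exists q : rat, 0 <= (ratr q : R) <= s /\ s - e < ratr q.
Proof.
rewrite le_eqVlt => /predU1P[<-|s0] e0.
  by exists 0; rewrite rmorph0 lexx sub0r oppr_lt0.
have /rat_in_itvoo[q] : Num.max 0 (s - e) < s by rewrite gt_max s0 /= ltrBlDr ltrDl.
rewrite in_itv /= gt_max => /andP[/andP[q0 sq] qs].
by exists q; rewrite (ltW q0) (ltW qs).
Qed.

(* The exceptional null sets of the hypotheses depend on [(s, t)]; rational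
   pairs and continuity make them uniform. Approximating [s] and [t] from below
   spares the continuity of powers. *)
Lemma sign_growth_ae (Om : set RN) (h : RN -> R -> R -> R) (r theta d1 d2 : R) :
  0 < r -> 0 < theta -> 0 < d1 -> 0 < d2 ->
  caratheodory_function Om h ->
  (forall s t : R, {ae lebesgue, forall x, Om x ->
       d1 * `|s| `^ r * `|t| `^ (theta + 1) <= h x s t * t}) ->
  (forall s t : R, {ae lebesgue, forall x, Om x ->
       `|h x s t| <= d2 * `|s| `^ r * `|t| `^ theta}) ->
  {ae lebesgue, forall x, Om x -> forall s t : R, 0 <= s -> 0 <= t ->
     0 <= h x s t /\ (t <= 1 -> h x s t <= d2 * s `^ r)}.
Proof.
move=> r0 th0 d10 d20 [_ hcont] hlow hup.
(* Natural numbers encode the pairs of rationals, which turns the family of a.e. bounds into a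
   sequence; a number that encodes no pair imposes nothing. *)
pose P n x := if @unpickle (rat * rat)%type n is Some q then Om x ->
  d1 * `|ratr q.1 : R| `^ r * `|ratr q.2 : R| `^ (theta + 1) <=
    h x (ratr q.1) (ratr q.2) * ratr q.2 /\
  `|h x (ratr q.1) (ratr q.2)| <= d2 * `|ratr q.1 : R| `^ r * `|ratr q.2 : R| `^ theta
  else True.
have aeP : {ae lebesgue, forall x n, P n x}.
  apply/ae_foralln => n; rewrite /P.
  case: unpickle => [[a b]|]; last exact: aeW.
  have := hlow (ratr a) (ratr b); have := hup (ratr a) (ratr b).
  by apply: filterS2 => x A B Ox; split; [exact: B|exact: A].
apply: filterS2 hcont aeP => x hc Px Ox s t s0 t0.
have {}hc := hc Ox.
have {}Px (a b : rat) : d1 * `|ratr a : R| `^ r * `|ratr b : R| `^ (theta + 1) <=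
    h x (ratr a) (ratr b) * ratr b /\
  `|h x (ratr a) (ratr b)| <= d2 * `|ratr a : R| `^ r * `|ratr b : R| `^ theta.
  by have := Px (pickle (a, b)); rewrite /P pickleK; exact.
split.
  rewrite leNgt; apply/negP => hneg.
  have : nbhs (s, t) [set z : R * R | h x z.1 z.2 < 0].
    exact: cvgr_lt (hc (s, t)) _ hneg.
  move=> /nbhs_ballP[e /= e0 he].
  have [a [/andP[a0 sa] sea]] := rat_approx_below s0 e0.
  (* The second rational is taken above [t], hence positive even when t = 0, so that the sign of h b
     gives the sign of h. *)
  have /rat_in_itvoo[b] : t < t + e by rewrite ltrDl.
  rewrite in_itv /= => /andP[tb bte].
  have := he (ratr a, ratr b); rewrite /ball /= /prod_ball /ball /= /ball_ /=.
  have b0 : 0 < (ratr b : R) by exact: le_lt_trans tb.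
  rewrite !ltr_norml => /(_ ltac:(by split; lra)).
  apply/negP; rewrite -leNgt -(pmulr_lge0 _ b0).
  apply: le_trans (Px a b).1.
  by rewrite !mulr_ge0 ?powR_ge0 ?(ltW d10).
(* Now both rationals lie below, so a^r <= s^r and b^theta <= 1, against a strict inequality that
   persists near (s, t). *)
move=> t1; rewrite leNgt; apply/negP => hbig.
have : nbhs (s, t) [set z : R * R | d2 * s `^ r < h x z.1 z.2].
  exact: cvgr_gt (hc (s, t)) _ hbig.
move=> /nbhs_ballP[e /= e0 he].
have [a [/andP[a0 sa] sea]] := rat_approx_below s0 e0.
have [b [/andP[b0 tb] teb]] := rat_approx_below t0 e0.
have := he (ratr a, ratr b); rewrite /ball /= /prod_ball /ball /= /ball_ /=.
rewrite !ltr_norml => /(_ ltac:(by split; lra)).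
apply/negP; rewrite -leNgt (le_trans (ler_norm _))// (le_trans (Px a b).2)//.
rewrite !ger0_norm// -mulrA ler_pM2l//.
rewrite -[leRHS]mulr1 ler_pM ?powR_ge0//.
  by rewrite ge0_ler_powR ?nnegrE ?(ltW r0).
have -> : 1 = 1 `^ theta :> R by rewrite powR1.
by rewrite ge0_ler_powR ?nnegrE ?(ltW th0)// (le_trans tb).
Qed.

End growth.

(** * Pointwise bound on the flux |X|^{p-2} X *)

Section flux.
Context (R : realType) (N : nat).
Local Notation RN := 'rV[R]_N.

Lemma powRD_le (p a b : R) : 0 <= p -> 0 <= a -> 0 <= b ->
  (a + b) `^ p <= 2 `^ p * (a `^ p + b `^ p).
Proof.
move=> p0 a0 b0.
have main (c d : R) : 0 <= c -> 0 <= d -> c <= d ->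
    (c + d) `^ p <= 2 `^ p * (c `^ p + d `^ p).
  move=> c0 d0 cd; apply: (@le_trans _ _ ((2 * d) `^ p)).
    by rewrite ge0_ler_powR ?nnegrE ?addr_ge0 ?mulr_ge0// mulr_natl mulr2n lerD2r.
  by rewrite powRM// ler_wpM2l ?powR_ge0// lerDr powR_ge0.
have [ab|/ltW ba] := leP a b; first exact: main.
by rewrite addrC [X in _ * X]addrC; exact: main.
Qed.

(** Replacing the smaller of [a] and [b] by the larger leaves a single p-th power. A crude form of
    the Young inequality suffices, since only finiteness of the final bound matters. *)
Lemma powR_young_crude (p a b : R) : 1 < p -> 0 <= a -> 0 <= b ->
  a `^ (p - 1) * b <= a `^ p + b `^ p.
Proof.
move=> p1 a0 b0.
have e (c : R) : 0 <= c -> c `^ p = c `^ (p - 1) * c.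
  rewrite le_eqVlt => /predU1P[<-|c0].
    by rewrite mulr0 powR0// gt_eqF// (lt_trans _ p1).
  rewrite -[X in _ * X]powRr1 ?(ltW c0)// -powRD ?subrK//.
  by rewrite (gt_eqF c0) implybT.
have [ab|/ltW ba] := leP a b.
  rewrite (e b b0) (@le_trans _ _ (b `^ (p - 1) * b))//.
    by rewrite ler_wpM2r// ge0_ler_powR ?nnegrE// subr_ge0 ltW.
  by rewrite lerDr powR_ge0.
rewrite (e a a0) (@le_trans _ _ (a `^ (p - 1) * a))//.
  by rewrite ler_wpM2l// powR_ge0.
by rewrite lerDl powR_ge0.
Qed.

Lemma enorm_ge0 (X : RN) : 0 <= enorm X.
Proof. exact: sqrtr_ge0. Qed.

Lemma entry_le_enorm (X : RN) i : `|X 0 i| <= enorm X.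
Proof.
rewrite -sqrtr_sqr ler_sqrt; last by apply: sumr_ge0 => *; exact: sqr_ge0.
by rewrite (bigD1 i) //= lerDl; apply: sumr_ge0 => *; exact: sqr_ge0.
Qed.

(** The Euclidean norm is at most [N] times the largest entry, whose p-th power is one term of the
    sum. This passes to coordinates, where [in_Lp] is available. *)
Lemma enorm_powR_le (p : R) (X : RN) : 0 < p ->
  enorm X `^ p <= N%:R `^ p * \sum_i `|X 0 i| `^ p.
Proof.
(* In dimension 0 there is no largest entry, but both sides vanish. *)
move=> p0; have [N0|i0] := posnP N.
  have noord (i : 'I_N) : False by case: i => j; rewrite N0 ltn0.
  rewrite /enorm !big1 => [|i|i]; [|by have := noord i|by have := noord i].
  by rewrite mulr0 sqrtr0 powR0// gt_eqF.
pose k := [arg max_(i > Ordinal i0) `|X 0 i|]%O.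
have kmax j : `|X 0 j| <= `|X 0 k| by rewrite /k; case: arg_maxP => //= i _; exact.
have step : enorm X <= N%:R * `|X 0 k|.
  have -> : N%:R * `|X 0 k| = Num.sqrt ((N%:R * `|X 0 k|) ^+ 2).
    by rewrite sqrtr_sqr normrM normr_id ger0_norm.
  rewrite ler_sqrt ?sqr_ge0//.
  apply: (@le_trans _ _ (\sum_(i < N) `|X 0 k| ^+ 2)).
    by apply: ler_sum => i _; rewrite -normrX -[X 0 i ^+ 2]ger0_norm ?sqr_ge0// !normrX lerXn2r ?nnegrE.
  rewrite sumr_const card_ord -[leLHS]mulr_natl exprMn ler_wpM2r ?sqr_ge0//.
  by rewrite -natrX ler_nat leq_pmulr.
apply: (@le_trans _ _ ((N%:R * `|X 0 k|) `^ p)).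
  by rewrite ge0_ler_powR ?nnegrE ?enorm_ge0 ?mulr_ge0// ltW.
rewrite powRM// ler_wpM2l ?powR_ge0// (bigD1 k) //= lerDl.
by apply: sumr_ge0 => *; exact: powR_ge0.
Qed.

(** Each term is at most |X|^{p-1} |Z_i|; apply Young, then split Z_i as (Z_i - X_i) + X_i. In the
    application [X] is the weak gradient, [Z] the gradient of an approximating test function and [Y]
    that of its cut-off, so the differences Z_i - X_i are small in L^p. *)
Lemma p_flux_bound (p : R) (X Y Z : RN) : 1 < p ->
  (forall i, `|Y 0 i| <= `|Z 0 i|) ->
  `|dotv (p_flux p X) Y| <= (N%:R * N%:R `^ p + 2 `^ p) *
     (\sum_i `|X 0 i| `^ p + \sum_i `|Z 0 i - X 0 i| `^ p).
Proof.
move=> p1 YZ.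
have p0 : 0 < p by exact: lt_trans p1.
have one i : `|p_flux p X 0 i * Y 0 i| <= N%:R `^ p * (\sum_j `|X 0 j| `^ p) +
    2 `^ p * (`|Z 0 i - X 0 i| `^ p + `|X 0 i| `^ p).
  rewrite /p_flux mxE !normrM (ger0_norm (powR_ge0 _ _)).
  apply: (@le_trans _ _ (enorm X `^ (p - 1) * `|Z 0 i|)).
    apply: ler_pM; [by rewrite mulr_ge0 ?powR_ge0|by []| |exact: YZ].
    (* The exponent p - 2 may be negative, and adding exponents requires |X| > 0; when |X| = 0 the
       entry itself is 0. *)
    have := enorm_ge0 X; rewrite le_eqVlt => /predU1P[X0|Xgt0].
      have := entry_le_enorm X i; rewrite -X0 normr_le0 => /eqP ->.
      by rewrite normr0 mulr0 powR_ge0.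
    have -> : enorm X `^ (p - 1) = enorm X `^ (p - 2) * enorm X.
      rewrite -[X in _ * X]powRr1 ?enorm_ge0// -powRD; last by rewrite (gt_eqF Xgt0) implybT.
      by congr powR; ring.
    by rewrite ler_wpM2l ?powR_ge0// entry_le_enorm.
  apply: (le_trans (powR_young_crude p1 (enorm_ge0 X) (normr_ge0 _))).
  apply: lerD; first exact: enorm_powR_le.
  apply: le_trans (powRD_le (ltW p0) (normr_ge0 _) (normr_ge0 _)).
  rewrite ge0_ler_powR ?nnegrE ?addr_ge0 ?(ltW p0)//.
  by rewrite -[X in `|X| <= _](subrK (X 0 i)) ler_normD.
apply: (le_trans (ler_norm_sum _ _ _)).
apply: (le_trans (ler_sum _ (fun i _ => one i))).
rewrite big_split /= sumr_const card_ord -mulr_sumr big_split /=.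
set s := \sum_j _; set t := \sum_i `|_ - _| `^ p.
have s0 : 0 <= s by apply: sumr_ge0 => *; exact: powR_ge0.
have t0 : 0 <= t by apply: sumr_ge0 => *; exact: powR_ge0.
rewrite -[X in X + _]mulr_natl mulrA [leRHS]mulrDl (addrC t) lerD2r ler_wpM2l ?mulr_ge0 ?powR_ge0//.
by rewrite lerDl.
Qed.

End flux.

(** * Membership and convergence in L^q through integrals of q-th powers *)

Section lp.
Context (R : realType) (N : nat) (Om : set 'rV[R]_N).
Local Notation RN := 'rV[R]_N.

Lemma Lnorm_restrict (q : R) (F : RN -> R) : q != 0 ->
  ('N[lebesgue]_q%:E[EFin \o (F \_ Om)] `^ q =
   \int[lebesgue]_(x in Om) (`|F x| `^ q)%:E)%E.
Proof.
move=> q0; rewrite poweR_Lnorm// [RHS]integral_mkcond; apply: eq_integral => x _.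
rewrite /= /patch; case: ifP => // _.
by rewrite (_ : point = 0 :> R) // normr0 powR0.
Qed.

Lemma in_Lp_measurable q F : measurable Om -> in_Lp Om q F -> measurable_fun Om F.
Proof.
move=> mOm /andP[]; rewrite inE /= => mF _.
by have /measurable_restrict := mF; rewrite setTI; exact.
Qed.

Lemma in_Lp_integral_lty q F : 0 < q -> in_Lp Om q F ->
  (\int[lebesgue]_(x in Om) (`|F x| `^ q)%:E < +oo)%E.
Proof.
move=> q0 /andP[_]; rewrite inE /= => fF.
rewrite -Lnorm_restrict ?gt_eqF//; exact: poweR_lty.
Qed.

Lemma Lp_cvg_integral q Fn F : 0 < q -> Lp_cvg Om q Fn F ->
  forall e, 0 < e -> \forall n \near \oo,
    (\int[lebesgue]_(x in Om) (`|Fn n x - F x| `^ q)%:E <= e%:E)%E.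
Proof.
move=> q0 /fine_cvgP[fin cv] e e0.
have d0 : 0 < e `^ q^-1 by rewrite powR_gt0.
have lt : \forall n \near \oo,
    fine ('N[lebesgue]_q%:E[EFin \o ((Fn n \- F)%R \_ Om)])%E < e `^ q^-1.
  exact: cvgr_lt cv _ d0.
apply: filterS2 fin lt => n {}fin {}lt.
rewrite -Lnorm_restrict ?gt_eqF//.
rewrite -(fineK fin) poweR_EFin lee_fin.
apply: (@le_trans _ _ ((e `^ q^-1) `^ q)).
  rewrite ge0_ler_powR ?nnegrE ?powR_ge0 ?(ltW q0) ?(ltW lt)// fine_ge0//.
  exact: Lnorm_ge0.
by rewrite -powRrM mulVf ?gt_eqF// powRr1// ltW.
Qed.

Lemma in_L1_of_integrable F : measurable Om ->
  lebesgue.-integrable Om (EFin \o F) -> in_Lp Om 1 F.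
Proof.
move=> mOm /(integrable_mkcond _ mOm); rewrite restrict_EFin => iF.
exact/Lfun1_integrable.
Qed.

End lp.
(** * Testing with cut-offs *)

Section testing.
Context (R : realType) (N : nat) (Om : set 'rV[R]_N).
Local Notation RN := 'rV[R]_N.

(** The product vanishes off the compact support [K] of [psi], and on [K] it is dominated by |F|,
    which is integrable there. *)
Lemma in_L1loc_test_integrable (F psi : RN -> R) : measurable Om ->
  in_L1loc Om F -> test_function Om psi -> (forall x, `|psi x| <= 1) ->
  lebesgue.-integrable Om (EFin \o (F \* psi)).
Proof.
move=> mOm [mF iF] [spsi cpsi subpsi] psi1.
set K := closure _ in cpsi subpsi.
have mK : measurable K.
  rewrite -(setCK K); apply/measurableC/open_measurable_rV.
  by rewrite openC; exact: closed_closure.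
have mpsi : measurable_fun Om psi by apply: continuous_measurable_rV; exact: (spsi [::]).1.
have iK : lebesgue.-integrable setT ((EFin \o F) \_ K).
  exact/(integrable_mkcond _ mK)/iF.
apply: (@le_integrable _ _ _ _ _ mOm _ ((EFin \o F) \_ K)).
- by apply/measurable_EFinP; exact: measurable_funM.
- move=> x Ox; rewrite /= /patch; case: ifPn => [_|].
    by rewrite /= lee_fin normrM ler_piMr.
  move=> /negP xK; have -> : psi x = 0.
    apply/eqP/negPn/negP => px; apply: xK; rewrite inE; exact: subset_closure.
  by rewrite mulr0 normr0; exact: abse_ge0.
- exact: integrableS iK.
Qed.

Lemma measurable_fun_enorm (D : set RN) (X : RN -> RN) :
  (forall i, measurable_fun D (fun x => X x 0 i)) ->
  measurable_fun D (fun x => enorm (X x)).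
Proof.
move=> mX; apply: (@measurableT_comp _ _ _ _ _ _ (@Num.sqrt R)).
  exact: (continuous_measurable_fun (@sqrt_continuous R)).
by apply: measurable_sum => i; exact: measurable_funX.
Qed.

(** The chain rule factor is 2 phi / (1 + phi^2)^2, and 2 |phi| <= 1 + phi^2 <= (1 + phi^2)^2. *)
Lemma cutoff_gradient_le (phi : RN -> R) (x : RN) i : smooth phi ->
  `|gradient (cutoff phi) x 0 i| <= `|partial i phi x|.
Proof.
move=> sphi; rewrite mxE partial_cutoff// normrM ler_piMl//.
have c0 := cutoff_den_gt0 phi x.
rewrite /cutoff_inv normrM exprVn normfV ler_pdivrMl ?mulr1; last first.
  by rewrite normr_gt0 gt_eqF// exprn_gt0.
rewrite [leRHS]ger0_norm ?sqr_ge0// ler_norml.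
have h : 0 <= phi x ^+ 2 by exact: sqr_ge0.
have : 1 + phi x ^+ 2 <= (1 + phi x ^+ 2) ^+ 2 by rewrite expr2 ler_peMr ?(ltW c0)// lerDl.
have := (sqr_ge0 (phi x - 1), sqr_ge0 (phi x + 1)).
by move=> [h1 h2] h3; apply/andP; split; lra.
Qed.

Lemma ge0_integral_sum_EFin (D : set RN) (I : finType) (F : I -> RN -> R) :
  measurable D -> (forall i, measurable_fun D (F i)) -> (forall i x, 0 <= F i x) ->
  (\int[lebesgue]_(x in D) (\sum_i F i x)%:E =
   \sum_i \int[lebesgue]_(x in D) (F i x)%:E)%E.
Proof.
move=> mD mF F0; under eq_integral do rewrite -sumEFin.
rewrite ge0_integral_sum// => i; first exact/measurable_EFinP.
by move=> x _; rewrite lee_fin.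
Qed.

(** Integrating [p_flux_bound] leaves the integrals of |X_i|^p, which are fixed, and [N] error
    integrals, each at most 1. The point is that [C] is chosen before [phi]. *)
Lemma flux_integral_bound (p : R) (X : RN -> RN) : 1 < p -> measurable Om ->
  (forall i, in_Lp Om p (fun x => X x 0 i)) ->
  exists C : R, forall phi, test_function Om phi ->
    (forall i, (\int[lebesgue]_(x in Om) (`|partial i phi x - X x 0 i| `^ p)%:E <= 1)%E) ->
    `|\int[lebesgue]_(x in Om) dotv (p_flux p (X x)) (gradient (cutoff phi) x)| <= C.
Proof.
move=> p1 mOm LX; have p0 : 0 < p by exact: lt_trans p1.
have mX i : measurable_fun Om (fun x => X x 0 i) by exact: in_Lp_measurable (LX i).
pose I i := (\int[lebesgue]_(x in Om) (`|X x 0 i| `^ p)%:E)%E.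
have Ifin i : I i \is a fin_num.
  rewrite ge0_fin_numE; first exact: in_Lp_integral_lty.
  by apply: integral_ge0 => x _; rewrite lee_fin powR_ge0.
pose c : R := N%:R * N%:R `^ p + 2 `^ p.
have c0 : 0 <= c by rewrite addr_ge0 ?mulr_ge0 ?powR_ge0.
exists (c * (\sum_i fine (I i) + N%:R)) => phi tphi dphi.
have [sphi _ _] := tphi.
have [scut _ _] := cutoff_test_function sphi tphi.
have mpart i : measurable_fun Om (partial i phi).
  by apply: continuous_measurable_rV; exact: (sphi [:: i]).1.
have mcut i : measurable_fun Om (partial i (cutoff phi)).
  by apply: continuous_measurable_rV; exact: (scut [:: i]).1.
have mdot : measurable_fun Om (fun x => dotv (p_flux p (X x)) (gradient (cutoff phi) x)).
  apply: measurable_sum => i.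
  under eq_fun do rewrite !mxE.
  have mE : measurable_fun Om (fun x => enorm (X x) `^ (p - 2)).
    apply: (measurableT_comp (measurable_powR (p - 2))).
    exact: measurable_fun_enorm.
  exact: (measurable_funM (measurable_funM mE (mX i)) (mcut i)).
have mpow (F : RN -> R) : measurable_fun Om F -> measurable_fun Om (fun x => `|F x| `^ p).
  move=> mF; apply: (measurableT_comp (measurable_powR p)).
  exact: (measurableT_comp (@normr_measurable R setT)).
have mdiff i : measurable_fun Om (fun x => partial i phi x - X x 0 i).
  exact: measurable_funB.
(* The real integral is the finite part of the extended one; a finite bound on the latter rules out
   infinite values. *)
suff : (`|\int[lebesgue]_(x in Om) (dotv (p_flux p (X x)) (gradient (cutoff phi) x))%:E| <=
    (c * (\sum_i fine (I i) + N%:R))%:E)%E.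
  by rewrite /Rintegral; case: (integral _ _ _) => [y|//|//] /=; rewrite lee_fin.
apply: le_trans (le_abse_integral _ mOm _) _; first exact/measurable_EFinP.
pose B1 x := \sum_i `|X x 0 i| `^ p.
pose B2 x := \sum_i `|partial i phi x - X x 0 i| `^ p.
have mB1 : measurable_fun Om B1 by apply: measurable_sum => i; exact: mpow.
have mB2 : measurable_fun Om B2 by apply: measurable_sum => i; exact: mpow.
have B10 x : 0 <= B1 x by apply: sumr_ge0 => *; exact: powR_ge0.
have B20 x : 0 <= B2 x by apply: sumr_ge0 => *; exact: powR_ge0.
apply: (@le_trans _ _ (\int[lebesgue]_(x in Om) (c%:E * ((B1 x)%:E + (B2 x)%:E))))%E.
  apply: ge0_le_integral.
  - exact: mOm.
  - by move=> x _; exact: abse_ge0.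
  - apply/measurable_EFinP.
    exact: (measurableT_comp (@normr_measurable R setT) mdot).
  - apply/measurable_EFinP.
    exact: (measurable_funM (measurable_cst c) (measurable_funD mB1 mB2)).
  move=> x _; rewrite -EFinD -EFinM lee_fin.
  have /= := @p_flux_bound R N p (X x) (gradient (cutoff phi) x) (gradient phi x) p1.
  have -> : B2 x = \sum_i `|gradient phi x 0 i - X x 0 i| `^ p.
    by apply: eq_bigr => i _; rewrite mxE.
  by apply => i; rewrite [gradient phi x 0 i]mxE; exact: cutoff_gradient_le.
have B1E x : Om x -> (0 <= (B1 x)%:E)%E by rewrite lee_fin.
have B2E x : Om x -> (0 <= (B2 x)%:E)%E by rewrite lee_fin.
have mB1E : measurable_fun Om (fun x => (B1 x)%:E) by exact/measurable_EFinP.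
have mB2E : measurable_fun Om (fun x => (B2 x)%:E) by exact/measurable_EFinP.
rewrite (ge0_integralZl_EFin _ mOm _ _ c0); last 2 first.
- by move=> x _; rewrite -EFinD lee_fin addr_ge0.
- by apply/measurable_EFinP; exact: (measurable_funD mB1 mB2).
rewrite (ge0_integralD _ mOm B1E mB1E B2E mB2E).
rewrite EFinM; apply: lee_wpmul2l; first by rewrite lee_fin.
rewrite EFinD; apply: leeD.
  rewrite (ge0_integral_sum_EFin mOm (fun i => mpow _ (mX i))); last first.
    by move=> i x; exact: powR_ge0.
  rewrite -sumEFin.
  by apply: lee_sum => i _; rewrite fineK.
rewrite (ge0_integral_sum_EFin mOm (fun i => mpow _ (mdiff i))); last first.
  by move=> i x; exact: powR_ge0.
apply: (@le_trans _ _ (\sum_(i < N) 1%:E)%E); first exact: lee_sum.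
by rewrite sumEFin sumr_const card_ord.
Qed.

(** Monotone convergence: at each point the truncations of [F] increase and are eventually equal to
    it. This reduces to bounded weights, the situation of [bump_dist]. *)
Lemma integral_truncation_le (D : set RN) (F B : RN -> R) (M : \bar R) :
  measurable D -> measurable_fun D F -> measurable_fun D B ->
  (forall x, 0 <= F x) -> (forall x, 0 <= B x) ->
  (forall n : nat,
     (\int[lebesgue]_(x in D) (Num.min (F x) n.+1%:R * B x)%:E <= M)%E) ->
  (\int[lebesgue]_(x in D) (F x * B x)%:E <= M)%E.
Proof.
move=> mD mF mB F0 B0 leM.
pose g n x := (Num.min (F x) n.+1%:R * B x)%:E.
have := @cvg_monotone_convergence _ _ _ lebesgue D mD g.
have -> : (fun x => limn (g^~ x)) = (fun x => (F x * B x)%:E).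
  apply/funext => x; apply: lim_near_cst => //.
  near=> n; rewrite /g min_l//.
  near: n; exists (Num.truncn (F x)) => // n /= Fn.
  by rewrite (le_trans (ltW (truncnS_gt _)))// ler_nat ltnS.
move=> H; apply: (@cvge_le _ \oo _ _ (fun n => \int[lebesgue]_(x in D) g n x)%E).
  by apply: nearW => n; exact: leM.
apply: H => [n|n x _|x _ m n mn].
- apply/measurable_EFinP.
  have mmin : measurable_fun D (fun x => Num.min (F x) n.+1%:R).
    exact: (measurable_minr mF (measurable_cst _)).
  exact: (measurable_funM mmin mB).
- by rewrite lee_fin mulr_ge0// le_min F0 ler0n.
- rewrite lee_fin ler_wpM2r// le_min ge_min lexx /= ge_min ler_nat ltnS mn orbT.
Unshelve. all: by end_near. Qed.

End testing.

(** * Weighted integrability of the source term *)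

Section source.
Context (R : realType) (N : nat) (Om : set 'rV[R]_N).
Local Notation RN := 'rV[R]_N.

(** For each truncation level k, an index n depending on k makes the error of replacing [v] by
    [phi n] at most |Om| + 1, while the equation tested with the cut-off of [phi n] contributes at
    most |A| C. The total is independent of k. *)
Lemma source_bump_integral_lty (p A : R) (v H : RN -> R) (X : RN -> RN)
    (phi : nat -> RN -> R) :
  measurable Om -> (lebesgue Om < +oo)%E -> 1 < p ->
  measurable_fun Om v -> (forall i, in_Lp Om p (fun x => X x 0 i)) ->
  in_L1loc Om H -> {ae lebesgue, forall x, Om x -> 0 <= H x} ->
  (forall n, test_function Om (phi n)) -> Lp_cvg Om p phi v ->
  (forall i, Lp_cvg Om p (fun n => partial i (phi n)) (fun x => X x 0 i)) ->
  (forall psi, test_function Om psi ->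
     A * \int[lebesgue]_(x in Om) dotv (p_flux p (X x)) (gradient psi x) =
     \int[lebesgue]_(x in Om) (H x * psi x)) ->
  (\int[lebesgue]_(x in Om) (Num.max (H x) 0 * bump (v x))%:E < +oo)%E.
Proof.
move=> mOm fOm p1 mv LX HL1 H0 tphi cphi cdphi weak.
have p0 : 0 < p by exact: lt_trans p1.
have [C hC] := flux_integral_bound p1 mOm LX.
have mH : measurable_fun Om H by case: HL1.
have mHp : measurable_fun Om (fun x => Num.max (H x) 0).
  exact: (measurable_maxr mH (measurable_cst _)).
have mbv : measurable_fun Om (fun x => bump (v x)).
  exact: (measurableT_comp (continuous_measurable_fun (@continuous_bump R)) mv).
have Hp0 x : 0 <= Num.max (H x) 0 by rewrite le_max lexx orbT.
apply: (@le_lt_trans _ _ ((`|A| * C)%:E + (lebesgue Om + 1))%E); last first.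
  by rewrite lte_add_pinfty ?ltry// lte_add_pinfty ?ltry.
apply: integral_truncation_le => // [x|k0]; first exact: bump_ge0.
set k : R := k0.+1%:R.
have k_gt0 : 0 < k by rewrite ltr0n.
have kp0 : 0 < k * k `^ p by rewrite mulr_gt0// powR_gt0.
(* This tolerance cancels the factor k k^p of [bump_dist], so that the distance term integrates to
   at most 1. *)
have near1 := Lp_cvg_integral p0 cphi (e := (k * k `^ p)^-1) ltac:(by rewrite invr_gt0).
have near2 : \forall n \near \oo, forall i,
    (\int[lebesgue]_(x in Om) (`|partial i (phi n) x - X x 0 i| `^ p)%:E <= 1)%E.
  by apply: filter_forall => i; exact: (Lp_cvg_integral p0 (cdphi i) (e := 1)).
have [n [d1 d2]] := filter_ex (filterI near1 near2).
have [sphi _ _] := tphi n.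
have tpsi := cutoff_test_function sphi (tphi n).
set psi := cutoff (phi n) in tpsi.
have psiE x : psi x = bump (phi n x) by [].
have mphi : measurable_fun Om (phi n).
  by apply: continuous_measurable_rV; exact: (sphi [::]).1.
have mpsi : measurable_fun Om psi.
  exact: (measurableT_comp (continuous_measurable_fun (@continuous_bump R)) mphi).
have mdist : measurable_fun Om (fun x => `|phi n x - v x| `^ p).
  apply: (measurableT_comp (measurable_powR p)).
  exact: (measurableT_comp (@normr_measurable R setT) (measurable_funB mphi mv)).
pose G1 x := (Num.max (H x) 0 * psi x)%:E.
pose G2 x := (`|phi n x - v x| `^ p)%:E.
have mG1 : measurable_fun Om G1.
  by apply/measurable_EFinP; exact: (measurable_funM mHp mpsi).
have mG2 : measurable_fun Om G2 by exact/measurable_EFinP.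
have G10 x : Om x -> (0 <= G1 x)%E by move=> _; rewrite lee_fin mulr_ge0// psiE bump_ge0.
have G20 x : Om x -> (0 <= G2 x)%E by move=> _; rewrite lee_fin powR_ge0.
have mkG2 : measurable_fun Om (fun x => (k * k `^ p)%:E * G2 x)%E.
  exact: (measurable_funeM _ mG2).
have kG20 x : Om x -> (0 <= (k * k `^ p)%:E * G2 x)%E.
  by move=> Ox; rewrite mule_ge0 ?G20// lee_fin ltW.
have m1 : measurable_fun Om (fun x : RN => 1%E : \bar R) by exact: measurable_cst.
have m2 : measurable_fun Om (fun x => 1 + (k * k `^ p)%:E * G2 x)%E.
  exact: emeasurable_funD.
have p2 x : Om x -> (0 <= 1 + (k * k `^ p)%:E * G2 x)%E.
  by move=> Ox; rewrite adde_ge0 ?kG20.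
apply: (@le_trans _ _ (\int[lebesgue]_(x in Om) (G1 x + (1 + (k * k `^ p)%:E * G2 x)))%E).
  apply: ge0_le_integral.
  - exact: mOm.
  - move=> x _; rewrite lee_fin mulr_ge0 ?bump_ge0// le_min Hp0 ltW//.
  - apply/measurable_EFinP.
    have mmin : measurable_fun Om (fun x => Num.min (Num.max (H x) 0) k).
      exact: (measurable_minr mHp (measurable_cst _)).
    exact: (measurable_funM mmin mbv).
  - exact: emeasurable_funD.
  move=> x _; rewrite -EFinM -!EFinD lee_fin psiE.
  set c := Num.min _ _.
  have c0 : 0 <= c by rewrite le_min Hp0 ltW.
  have ck : c <= k by rewrite ge_min lexx orbT.
  have cH : c <= Num.max (H x) 0 by rewrite ge_min lexx.
  (* [bump_dist] is applied with the truncated value c of the source; afterwards c is raised to H in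
     the main term and to k in the error term. *)
  apply: (le_trans (bump_dist (v x) (phi n x) c0 p0)).
  rewrite -addrA lerD ?ler_wpM2r ?bump_ge0// lerD2l ler_wpM2r ?powR_ge0//.
  rewrite ler_pM ?powR_ge0// ge0_ler_powR ?nnegrE ?(ltW p0)//.
rewrite (ge0_integralD _ mOm G10 mG1 p2 m2).
rewrite (ge0_integralD _ mOm _ m1 kG20 mkG2); last by move=> x _; exact: lee01.
rewrite (ge0_integralZl_EFin _ mOm G20 mG2 (ltW kp0)).
apply: leeD; last first.
  apply: leeD; first by rewrite integral_cst// mul1e.
  have := lee_wpmul2l (x := (k * k `^ p)%:E) ltac:(by rewrite lee_fin ltW) d1.
  by rewrite -EFinM mulfV// gt_eqF.
(* Integrability identifies the extended integral with the real one in the weak equation. *)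
have iH : lebesgue.-integrable Om (EFin \o (H \* psi)).
  apply: in_L1loc_test_integrable => // x.
  by rewrite psiE ger0_norm ?bump_le1 ?bump_ge0.
have -> : (\int[lebesgue]_(x in Om) G1 x = \int[lebesgue]_(x in Om) (H x * psi x)%:E)%E.
  apply: ae_eq_integral => //.
  - by apply/measurable_EFinP; exact: (measurable_funM mH mpsi).
  - by apply: filterS H0 => x Hx Ox; rewrite /G1 max_l// Hx.
have fH := integrable_fin_num mOm iH.
have weakpsi := weak psi tpsi.
rewrite -(fineK fH) lee_fin.
rewrite [leLHS](_ : _ = \int[lebesgue]_(x in Om) (H x * psi x))//.
rewrite -weakpsi (le_trans (ler_norm _))// normrM ler_wpM2l//.
exact: hC.
Qed.

End source.

(** * Comparison of exponents *)

Section exponents.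
Context (R : realType).
Implicit Types p m s : R.

Lemma conj_sobolev_gt1 (N : nat) p : 1 < p < N%:R ->
  1 < conj_exp (sobolev_exp N p) /\
  conj_exp (sobolev_exp N p) = N%:R * p / (N%:R * p - N%:R + p).
Proof.
rewrite /conj_exp /sobolev_exp; move: (N%:R : R) => n /andP[p1 pn].
have np : 0 < n - p by lra.
have den : 0 < n * p - n + p by nra.
have E : n * p / (n - p) / (n * p / (n - p) - 1) = n * p / (n * p - n + p).
  by field; rewrite !gt_eqF//; lra.
by rewrite E; split => //; rewrite ltr_pdivlMr//; lra.
Qed.

(** Clearing denominators, both [tau_star N p m < p] and the bound of m by the conjugate of p^* read
    m (N p - N + p) < N p. *)
Lemma tau_star_lt (N : nat) p m : 1 < p < N%:R -> 1 < m < N%:R / p ->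
  m < conj_exp (sobolev_exp N p) -> tau_star N p m < p.
Proof.
move=> pN; have [_ ->] := conj_sobolev_gt1 pN.
rewrite /tau_star; move: (N%:R : R) pN => n /andP[p1 pn] /andP[m1].
have p0 : 0 < p by lra.
have den : 0 < n * p - n + p by nra.
rewrite !ltr_pdivlMr// => mn mnp.
have mn' : 0 < n - m by nra.
by rewrite ltr_pdivrMr//; nra.
Qed.

Lemma tau_star1_lt (N : nat) p : 1 < p < N%:R -> tau_star N p 1 < p.
Proof.
rewrite /tau_star; move: (N%:R : R) => n /andP[p1 pn].
by rewrite ltr_pdivrMr; nra.
Qed.

(** Since m p < N, clearing denominators turns both the claim and the last hypothesis into m (N (p -
    1) + p s) < N s. *)
Lemma tau_star2_lt (N : nat) p m s : 1 < p < N%:R -> 0 < s -> m < N%:R / p ->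
  m < N%:R * s / (N%:R * (p - 1) + p * s) -> tau_star2 N p m < s.
Proof.
rewrite /tau_star2; move: (N%:R : R) => n /andP[p1 pn] s0.
have p0 : 0 < p by lra.
have den : 0 < n * (p - 1) + p * s by nra.
rewrite !ltr_pdivlMr// => mn mns.
by rewrite ltr_pdivrMr; nra.
Qed.

End exponents.

(** Where v > 1 the weight [bump v] is at least 1/2, so H <= 2 H [bump v]. Where v <= 1, H <= d u^r
    <= d (1 + u^s), which is integrable because [Om] has finite measure. *)
Lemma source_integrable (R : realType) (N : nat) (Om : set 'rV[R]_N)
    (r s d : R) (u v H : 'rV[R]_N -> R) :
  measurable Om -> (lebesgue Om < +oo)%E -> 0 <= r -> r <= s -> 0 < s -> 0 <= d ->
  in_Lp Om s u -> measurable_fun Om v -> measurable_fun Om H ->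
  {ae lebesgue, forall x, Om x ->
     [/\ 0 <= u x, 0 <= H x & v x <= 1 -> H x <= d * u x `^ r]} ->
  (\int[lebesgue]_(x in Om) (Num.max (H x) 0 * bump (v x))%:E < +oo)%E ->
  lebesgue.-integrable Om (EFin \o H).
Proof.
move=> mOm fOm r0 rs s0 d0 us mv mH Hbd Hbump; apply/integrableP; split.
  exact/measurable_EFinP.
have mu : measurable_fun Om u by exact: in_Lp_measurable us.
have mHp : measurable_fun Om (fun x => Num.max (H x) 0).
  exact: (measurable_maxr mH (measurable_cst _)).
have mbv : measurable_fun Om (fun x => bump (v x)).
  exact: (measurableT_comp (continuous_measurable_fun (@continuous_bump R)) mv).
pose G1 x := (Num.max (H x) 0 * bump (v x))%:E.
pose G2 x := (`|u x| `^ s)%:E.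
have mG1 : measurable_fun Om G1.
  by apply/measurable_EFinP; exact: (measurable_funM mHp mbv).
have mG2 : measurable_fun Om G2.
  apply/measurable_EFinP; apply: (measurableT_comp (measurable_powR s)).
  exact: (measurableT_comp (@normr_measurable R setT) mu).
have G10 x : Om x -> (0 <= G1 x)%E.
  by move=> _; rewrite lee_fin mulr_ge0 ?bump_ge0// le_max lexx orbT.
have G20 x : Om x -> (0 <= G2 x)%E by move=> _; rewrite lee_fin powR_ge0.
have m1 : measurable_fun Om (fun x : 'rV[R]_N => 1%E : \bar R) by exact: measurable_cst.
have m1G2 : measurable_fun Om (fun x => 1 + G2 x)%E by exact: emeasurable_funD.
have p1G2 x : Om x -> (0 <= 1 + G2 x)%E by move=> Ox; rewrite adde_ge0 ?G20.
have m2G1 : measurable_fun Om (fun x => 2%:E * G1 x)%E by exact: (measurable_funeM _ mG1).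
have p2G1 x : Om x -> (0 <= 2%:E * G1 x)%E by move=> Ox; rewrite mule_ge0 ?G10.
have mdG2 : measurable_fun Om (fun x => d%:E * (1 + G2 x))%E by exact: (measurable_funeM _ m1G2).
have pdG2 x : Om x -> (0 <= d%:E * (1 + G2 x))%E by move=> Ox; rewrite mule_ge0 ?p1G2.
apply: (@le_lt_trans _ _ (\int[lebesgue]_(x in Om) (2%:E * G1 x + d%:E * (1 + G2 x)))%E).
  apply: ae_ge0_le_integral.
  - exact: mOm.
  - by move=> x _; exact: abse_ge0.
  - apply/measurable_EFinP.
    exact: (measurableT_comp (@normr_measurable R setT) mH).
  - by move=> x Ox; rewrite adde_ge0 ?p2G1 ?pdG2.
  - exact: emeasurable_funD.
  apply: filterS Hbd => x Hx Ox; have [u0 H0 Hv] := Hx Ox.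
  have -> : (2%:E * G1 x + d%:E * (1 + G2 x))%E =
      (2 * (Num.max (H x) 0 * bump (v x)) + d * (1 + `|u x| `^ s))%:E by [].
  rewrite /= lee_fin max_l// (ger0_norm u0) ger0_norm//.
  have u1 := powR_le_add1 r0 rs u0.
  have du : d * u x `^ r <= d * (1 + u x `^ s) by rewrite ler_wpM2l.
  have [/Hv Hd|/ltW/bump_ge_half b2] := leP (v x) 1.
    rewrite (le_trans Hd)// (le_trans du)// lerDr.
    by rewrite !mulr_ge0 ?bump_ge0.
  have : H x <= 2 * (H x * bump (v x)) by rewrite mulrCA ler_peMr.
  by have := mulr_ge0 d0 (addr_ge0 ler01 (powR_ge0 (u x) s)); lra.
rewrite (ge0_integralD _ mOm p2G1 m2G1 pdG2 mdG2).
rewrite (ge0_integralZl_EFin _ mOm G10 mG1 (ler0n _ 2)).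
rewrite (ge0_integralZl_EFin _ mOm p1G2 m1G2 d0).
rewrite (ge0_integralD _ mOm _ m1 G20 mG2); last by move=> x _; exact: lee01.
rewrite integral_cst// mul1e.
have fG2 := in_Lp_integral_lty s0 us.
apply: lte_add_pinfty; (apply: lte_mul_pinfty; [by rewrite lee_fin|by []|]).
  exact: Hbump.
exact: lte_add_pinfty.
Qed.

Unset Implicit Arguments.

Theorem corollary1p4 (R : realType) (N : nat) (Om : set 'rV[R]_N)
    (p r theta m c1 c2 d1 d2 : R) (g h : 'rV[R]_N -> R -> R -> R)
    (f u v : 'rV[R]_N -> R)
    (hN : (2 < N)%N) (hOm_open : open Om) (hOm_bounded : bounded_set Om)
    (hp : 1 < p < N%:R) (hr : 1 < r)
    (htheta : 0 < theta < Num.min (p - 1) (p ^+ 2 / (N%:R - p)))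
    (hg_car : caratheodory_function Om g) (hh_car : caratheodory_function Om h)
    (hc1 : 0 < c1) (hc2 : 0 < c2) (hd1 : 0 < d1) (hd2 : 0 < d2)
    (hg_low : forall s t : R, {ae lebesgue, forall x, Om x ->
       c1 * `|s| `^ r * `|t| `^ (theta + 1) <= g x s t * s})
    (hg_up : forall s t : R, {ae lebesgue, forall x, Om x ->
       `|g x s t| <= c2 * `|s| `^ (r - 1) * `|t| `^ (theta + 1)})
    (hh_low : forall s t : R, {ae lebesgue, forall x, Om x ->
       d1 * `|s| `^ r * `|t| `^ (theta + 1) <= h x s t * t})
    (hh_up : forall s t : R, {ae lebesgue, forall x, Om x ->
       `|h x s t| <= d2 * `|s| `^ r * `|t| `^ theta})
    (hm : Num.min (conj_exp (r + theta + 1)) (conj_exp (sobolev_exp N p))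
          < m < N%:R / p)
    (hf : in_Lp Om m f)
    (hf_ge0 : {ae lebesgue, forall x, Om x -> 0 <= f x})
    (hsol : solution Om p g h f u v)
    (hu : in_Lp Om (r + theta + 1) u)
    (hu_ge0 : {ae lebesgue, forall x, Om x -> 0 <= u x})
    (hv_ge0 : {ae lebesgue, forall x, Om x -> 0 <= v x}) :
  [/\ r + theta > sobolev_exp N p - 1 ->
        conj_exp (r + theta + 1) < m < conj_exp (sobolev_exp N p) ->
        sobolev_regularized Om p f m u,
      r + theta > sobolev_exp N p - 1 ->
        conj_exp (sobolev_exp N p) <= m <
          N%:R * (r + theta + 1) / (N%:R * (p - 1) + p * (r + theta + 1)) ->
        lebesgue_regularized Om p f m u
    & r + theta > sobolev_exp N p - 1 ->
        exists tau : R,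
          sobolev_regularized Om p (fun x => h x (u x) (v x)) tau v].
Proof.
have [p1 pN] := andP hp; have [th0 _] := andP htheta; have [_ mN] := andP hm.
have p0 : 0 < p by exact: lt_trans p1.
have [Du [Dv [[Wu Wv] _ hL1 _ weak]]] := hsol.
have [c1s _] := conj_sobolev_gt1 hp.
have s1 : 1 < r + theta + 1 by rewrite ltrDr addr_gt0// (lt_trans _ hr).
split.
- move=> _ /andP[ms mp].
  have m1 : 1 < m.
    apply: le_lt_trans ms; rewrite /conj_exp ler_pdivlMr ?subr_gt0//.
    by rewrite mul1r gerBl.
  split; [by rewrite (ltW m1) mN|exact: hf|exists p; last by exists Du].
  by rewrite gt_max p1 andbT tau_star_lt// m1.
- move=> _ /andP[pm ms]; have m1 : 1 < m by exact: lt_le_trans pm.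
  split; [by rewrite (ltW m1) mN|exact: hf|exists (r + theta + 1) => //].
  by rewrite gt_max s1 andbT tau_star2_lt// (lt_trans _ s1).
- move=> _; exists 1.
  have mOm : measurable Om by exact: open_measurable_rV.
  have fOm : (lebesgue Om < +oo)%E by exact: lebesgue_bounded_lty.
  have [Lv LDv _ [phi [tphi cphi cdphi]]] := Wv.
  have mv := in_Lp_measurable mOm Lv.
  have r0 : 0 < r by exact: lt_trans hr.
  (* The exceptional null set is the same for all (s, t), so s = u x and t = v x may be
     substituted. *)
  have Hbd := sign_growth_ae r0 th0 hd1 hd2 hh_car hh_low hh_up.
  have H0 : {ae lebesgue, forall x, Om x -> 0 <= h x (u x) (v x)}.
    apply: filterS3 Hbd hu_ge0 hv_ge0 => x Hx ux vx Ox.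
    exact: (Hx Ox _ _ (ux Ox) (vx Ox)).1.
  split; [|apply: in_L1_of_integrable => //|exists p; last by exists Dv].
  + by rewrite lexx ltr_pdivlMr// mul1r.
  + apply: (@source_integrable _ _ _ r (r + theta + 1) d2 u v) => //.
    * exact: ltW.
    * by rewrite -addrA lerDl addr_ge0// ltW.
    * exact: lt_trans s1.
    * exact: ltW.
    * by case: hL1.
    * apply: filterS3 Hbd hu_ge0 hv_ge0 => x Hx ux vx Ox.
      have [? ?] := Hx Ox _ _ (ux Ox) (vx Ox).
      by split => //; exact: ux.
    * exact: (source_bump_integral_lty mOm fOm p1 mv LDv hL1 H0 tphi cphi cdphi weak).
  + by rewrite gt_max p1 andbT tau_star1_lt.
Qed.
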